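(* Let $(G,\cdot)$ be a CIPL, let $f,g\in G$, and let $(G,\circ)$ be the $f,g$-principal isotope of $(G,\cdot)$. Suppose the $\mathcal{T}$ condition holds for $(G,\cdot)$ relative to $(G,\circ)$, and that $(G,\circ)$ is an AIPL. Then $f$ and $g$ are: 1. alternative elements: $(xx)y=x(xy)$ and $y(xx)=(yx)x$ for all $y\in G$ and $x\in\{f,g\}$; 2. flexible elements: $x(yx)=(xy)x$ for all $y\in G$ and $x\in\{f,g\}$; 3. centrum elements: $xy=yx$ for all $y\in G$ and $x\in\{f,g\}$; 4. equal elements: $f=g$. (Here juxtaposition is multiplication in $(G,\cdot)$.)
   Context: Maps are written on the right of their arguments and composed from left to right: $xAB=(xA)B$. A loop is a set with a binary operation for which $a\cdot x=b$ and $y\cdot a=b$ have unique solutions $x,y$ for all $a,b$, and which has a two-sided identity element $e$. For $x$ in a loop, $x^\rho$ and $x^\lambda$ denote the right and left inverses: $xx^\rho=e=x^\lambda x$. A loop is a cross inverse property loop (CIPL) if $xy\cdot x^\rho=y$ for all $x,y$. A loop is an automorphic inverse property loop (AIPL) if $(xy)^\rho=x^\rho y^\rho$ for all $x,y$. For $(G,\cdot)$ put $J_\rho:x\mapsto x^\rho$, $J_\lambda:x\mapsto x^\lambda$, $L_x:y\mapsto x\cdot y$, $R_x:y\mapsto y\cdot x$. The $f,g$-principal isotope of $(G,\cdot)$ is the loop $(G,\circ)$ on the same set with $xR_g\circ yL_f=x\cdot y$ for all $x,y\in G$, i.e. $(x\cdot g)\circ(f\cdot y)=x\cdot y$; $f$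 and $g$ are called its translation elements. $J_\rho',J_\lambda'$ are the right and left inverse maps of $(G,\circ)$. $\mathcal{T}$ conditions for this isotope: $\mathcal{T}_1$ means $R_g=L_f$; $\mathcal{T}_2$ means $J_\rho'=J_\rho L_f=R_g^{-1}J_\rho$; $\mathcal{T}_3$ means $J_\lambda'=J_\lambda R_g=L_f^{-1}J_\lambda$. The $\mathcal{T}$ condition holds if and only if $\mathcal{T}_1$ and $\mathcal{T}_2$ hold, or $\mathcal{T}_1$ and $\mathcal{T}_3$ hold ($\mathcal{T}_2$ and $\mathcal{T}_3$ being equivalent). *)

(* Defs.v *)
From mathcomp Require Import all_boot.
From mathcomp Require Import boolp.

Set Implicit Arguments.
Unset Strict Implicit.
Unset Printing Implicit Defensive.

(* A loop structure on a carrier G; several structures on the same carrier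
   are needed at once (a loop and its isotope), hence G is a parameter. *)
Record loop (G : Type) := Loop {
  lmul :> G -> G -> G;
  lid : G;
  lmul_idl : forall x, lmul lid x = x;
  lmul_idr : forall x, lmul x lid = x;
  ldiv_ex : forall a b, exists! x, lmul a x = b;
  rdiv_ex : forall a b, exists! y, lmul y a = b
}.

Section LoopOps.
Variables (G : Type) (Q : loop G).
Implicit Types a b x y : G.

Definition ldiv a b : G := projT1 (cid (ldiv_ex Q a b)).
Definition rdiv b a : G := projT1 (cid (rdiv_ex Q a b)).

Lemma ldivP a b : Q a (ldiv a b) = b.
Proof. by rewrite /ldiv; case: cid => x []. Qed.

Lemma rdivP b a : Q (rdiv b a) a = b.
Proof. by rewrite /rdiv; case: cid => x []. Qed.

Lemma lmulI a : injective (Q a).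
Proof.
by move=> x y exy; have [z [_ uz]] := ldiv_ex Q a (Q a y);
  rewrite -(uz x exy) (uz y erefl).
Qed.

Lemma lmulIr a : injective (Q^~ a).
Proof.
by move=> x y exy; have [z [_ uz]] := rdiv_ex Q a (Q y a);
  rewrite -(uz x exy) (uz y erefl).
Qed.

Definition ltrans a : G -> G := fun y => Q a y.
Definition rtrans a : G -> G := fun y => Q y a.
Definition ltransV a : G -> G := fun y => ldiv a y.
Definition rtransV a : G -> G := fun y => rdiv y a.

Lemma ltransK a : cancel (ltrans a) (ltransV a).
Proof. by move=> x; apply: (@lmulI a); rewrite ldivP. Qed.

Lemma ltransVK a : cancel (ltransV a) (ltrans a).
Proof. by move=> x; exact: ldivP. Qed.

Lemma rtransK a : cancel (rtrans a) (rtransV a).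
Proof. by move=> x; apply: (@lmulIr a); rewrite rdivP. Qed.

Lemma rtransVK a : cancel (rtransV a) (rtrans a).
Proof. by move=> x; exact: rdivP. Qed.

Definition rinv x : G := ldiv x (lid Q).
Definition linv x : G := rdiv (lid Q) x.

Lemma rinvP x : Q x (rinv x) = lid Q.
Proof. exact: ldivP. Qed.

Lemma linvP x : Q (linv x) x = lid Q.
Proof. exact: rdivP. Qed.

Definition cross_inverse_property := forall x y, Q (Q x y) (rinv x) = y.

Definition automorphic_inverse_property :=
  forall x y, rinv (Q x y) = Q (rinv x) (rinv y).

Definition alternative_elt x :=
  (forall y, Q (Q x x) y = Q x (Q x y)) /\
  (forall y, Q y (Q x x) = Q (Q y x) x).

Definition flexible_elt x := forall y, Q x (Q y x) = Q (Q x y) x.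

Definition centrum_elt x := forall y, Q x y = Q y x.

End LoopOps.

Section Isotopy.
Variables (G : Type) (Q P : loop G) (f g : G).

Definition principal_isotope := forall x y, P (Q x g) (Q f y) = Q x y.

(* Maps act on the right in the source, so a product AB of maps, meaning
   x(AB) = (xA)B, is rendered by the left-to-right composition A \; B. *)
Definition T1 := rtrans Q g =1 ltrans Q f.

Definition T2 :=
  rinv P =1 (rinv Q \; ltrans Q f) /\ rinv P =1 (rtransV Q g \; rinv Q).

Definition T3 :=
  linv P =1 (linv Q \; rtrans Q g) /\ linv P =1 (ltransV Q f \; linv Q).

Definition T_condition := (T1 /\ T2) \/ (T1 /\ T3).

End Isotopy.

(* The principal isotope exists for all translation elements; since
   translations are surjective, its operation is uniquely determined. *)
Lemma principal_isotope_ex (G : Type) (Q : loop G) (f g : G) :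
  exists P : loop G, principal_isotope Q P f g.
Proof.
pose op u v := Q (rtransV Q g u) (ltransV Q f v).
have idl x : op (Q f g) x = x.
  by rewrite /op (rtransK Q g f); exact: ltransVK.
have idr x : op x (Q f g) = x.
  by rewrite /op (ltransK Q f g); exact: rtransVK.
have lex a b : exists! x, op a x = b.
  exists (ltrans Q f (ldiv Q (rtransV Q g a) b)); split.
    by rewrite /op ltransK ldivP.
  move=> x <-; rewrite /op (_ : ldiv Q _ _ = ltransV Q f x) ?ltransVK //.
  exact: ltransK.
have rex a b : exists! y, op y a = b.
  exists (rtrans Q g (rdiv Q b (ltransV Q f a))); split.
    by rewrite /op rtransK rdivP.
  move=> y <-; rewrite /op (_ : rdiv Q _ _ = rtransV Q g y) ?rtransVK //.
  exact: rtransK.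
exists (Loop idl idr lex rex) => x y /=.
by rewrite /op (rtransK Q g x) (ltransK Q f y).
Qed.

(* Main.v *)
Require Import Defs.
From mathcomp Require Import all_boot.

(** Evaluating [T1] at the identity gives [f = g], so [T1] says that [f]
    commutes with everything, and flexibility follows at once.  Alternativity
    comes from the inverse maps.  Both [T2] and [T3] imply
    [rinv P z = f * rinv z]; feeding this into the automorphic inverse property
    of [P] at [x = u * f], [y = f * v], and using that a cross inverse property
    loop itself has the automorphic inverse property, turns it into the identity
    [f * (a * b) = (a * h) * (b * h)] in [Q], where [h := rinv f]
    ([transfer_aip]).  The cross inverse property says that [a |-> a * h]
    undoes left translation by [f].  Putting [a = f * f], [b = e] yields
    [f * (f * f) = e], hence [h = f * f]; putting then [a = e] or [b = e] yields
    the two alternative laws. *)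

Section CrossInverse.
Set Implicit Arguments.
Variables (G : Type) (Q : loop G).

Lemma rinv_linv x : rinv Q (linv Q x) = x.
Proof. by apply: (@lmulI _ Q (linv Q x)); rewrite rinvP linvP. Qed.

Lemma linv_rinv x : linv Q (rinv Q x) = x.
Proof. by apply: (@lmulIr _ Q (rinv Q x)); rewrite /= rinvP linvP. Qed.

(** The cross inverse property reads [u * rinv x = y] whenever [u = x * y].
    Applying it to the product [u * rinv x] gives [y * rinv u = rinv x], and
    applying it once more to that product gives the claim. *)
Lemma cip_aip : cross_inverse_property Q -> automorphic_inverse_property Q.
Proof.
move=> cip x y.
have y_inv : Q y (rinv Q (Q x y)) = rinv Q x.
  by rewrite -{1}(cip x y) cip.
by rewrite -y_inv cip.
Qed.

End CrossInverse.

Section Transfer.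
Set Implicit Arguments.
Variables (G : Type) (Q P : loop G) (f g : G).

Lemma T1_eq : T1 Q f g -> f = g.
Proof.
by move=> /(_ (lid Q)); rewrite /rtrans /ltrans lmul_idl lmul_idr => ->.
Qed.

Lemma T1_centrum : T1 Q f g -> centrum_elt Q f.
Proof. by move=> t1 y; rewrite {2}(T1_eq t1) -[RHS]/(rtrans Q g y) t1. Qed.

Lemma T2_rinv z : T2 Q P f g -> rinv P z = Q f (rinv Q z).
Proof. by case=> ->. Qed.

(** [T3] is [T2] read through the inverse bijections: its second half says that
    [f * rinv z] has left inverse [z] in [P]. *)
Lemma T3_rinv z : T3 Q P f g -> rinv P z = Q f (rinv Q z).
Proof.
move=> [_ /(_ (Q f (rinv Q z)))].
rewrite /= (ltransK Q f) linv_rinv => linvPz.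
by rewrite -{1}linvPz rinv_linv.
Qed.

Lemma T_condition_rinv z : T_condition Q P f g -> rinv P z = Q f (rinv Q z).
Proof. by case=> [[_ /T2_rinv]|[_ /T3_rinv]]. Qed.

(** On [u * f] and [f * v], and likewise on [rinv x * f] and [f * rinv y], the
    isotope's product is the product of [Q] with the factor [f] stripped off;
    this is what makes the inverse law of [P] an identity of [Q]. *)
Lemma transfer_aip a b :
  cross_inverse_property Q -> principal_isotope Q P f g ->
  T_condition Q P f g -> automorphic_inverse_property P ->
  Q f (Q a b) = Q (Q a (rinv Q f)) (Q b (rinv Q f)).
Proof.
move=> cipQ isoP TQP aipP.
have t1 : T1 Q f g by case: TQP => [][].
have fC := T1_centrum t1; have aipQ := cip_aip cipQ.
have isoPf x y : P (Q x f) (Q f y) = Q x y.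
  by rewrite {1}(T1_eq t1).
rewrite -(rinv_linv Q a) -(rinv_linv Q b) -!aipQ.
set u := linv Q a; set v := linv Q b.
have := aipP (Q u f) (Q f v).
by rewrite isoPf !(T_condition_rinv _ TQP) [Q f (rinv Q (Q u f))]fC isoPf
           [Q f v]fC -aipQ.
Qed.

End Transfer.

Lemma centrum_flexible (G : Type) (Q : loop G) (x : G) :
  centrum_elt Q x -> flexible_elt Q x.
Proof. by move=> xC y; rewrite -[Q y x]xC. Qed.

(** Since right translation by [rinv f] undoes left translation by [f], the
    identity assumed on [f] forces [f] to have cube [e]; so [f * f] is [rinv f],
    and its translations are given by the cases [a = e] and [b = e]. *)
Lemma centrum_alternative (G : Type) (Q : loop G) (f : G) :
    cross_inverse_property Q -> centrum_elt Q f ->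
    (forall a b, Q f (Q a b) = Q (Q a (rinv Q f)) (Q b (rinv Q f))) ->
  alternative_elt Q f.
Proof.
move=> cip fC mulf.
have fa a : Q f a = Q (Q a (rinv Q f)) (rinv Q f).
  by rewrite -{1}[a](lmul_idr Q) mulf lmul_idl.
have fb b : Q f b = Q (rinv Q f) (Q b (rinv Q f)).
  by rewrite -{1}[b](lmul_idl Q) mulf lmul_idl.
have ff : Q f f = rinv Q f.
  by apply: (@lmulI _ Q f); rewrite fa cip.
split=> y; rewrite ff.
  by rewrite [RHS]fb cip.
by rewrite -[RHS]fC -[Q y f]fC [RHS]fa cip.
Qed.

Theorem corollary3p5 (G : Type) (Q P : loop G) (f g : G)
  (cipQ : cross_inverse_property Q)
  (isoP : principal_isotope Q P f g)
  (TQP : T_condition Q P f g)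
  (aipP : automorphic_inverse_property P) :
  (alternative_elt Q f /\ alternative_elt Q g) /\
  (flexible_elt Q f /\ flexible_elt Q g) /\
  (centrum_elt Q f /\ centrum_elt Q g) /\
  f = g.
Proof.
have t1 : T1 Q f g by case: TQP => [][].
have fC := T1_centrum t1.
have fA : alternative_elt Q f.
  apply: centrum_alternative => // a b.
  exact: (transfer_aip a b cipQ isoP TQP aipP).
have fF : flexible_elt Q f by exact: centrum_flexible.
by rewrite -(T1_eq t1).
Qed.
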